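(* Let $p<q$ be primes, $\xi=\log q/\log p$, let $(a,b)$ be an upper or lower best approximation for $\xi$, and set $\alpha=p^a/q^b$. Then the map $\phi:\mathcal V(\alpha)\to\mathcal B(\alpha)$ given by $\phi(\mathbf x)=A_{\mathbf x}$ (its equivalence class) is a bijection.
   Context: $\mathbb N_0=\{0,1,2,\dots\}$, $\mathcal N=\{(a,b)\in\mathbb N_0^2:(a,b)\neq(0,0)\}$, $\mathcal G=\{(a,b)\in\mathcal N:\gcd(a,b)=1\}$ (convention $\gcd(a,0)=a$; $a/0=\infty$ for $a\in\mathbb N$). For positive irrational $\xi$: $\mathcal U(\xi)=\{(a,b)\in\mathcal N:a>b\xi\}$, $\mathcal L(\xi)=\{(a,b)\in\mathcal N:a<b\xi\}$, $\mathcal U_1(\xi)=\{(a,b)\in\mathcal U(\xi): a/b=\min\{m/n:(m,n)\in\mathcal U(\xi),\ m\le a\}\}$, $\mathcal L_2(\xi)=\{(a,b)\in\mathcal L(\xi): a/b=\max\{m/n:(m,n)\in\mathcal L(\xi),\ n\le b\}\}$; upper (resp. lower) best approximations for $\xi$ are elements of $\mathcal G\cap\mathcal U_1(\xi)$ (resp. $\mathcal G\cap\mathcal L_2(\xi)$). A factorization of a positive rational $\alpha\neq1$ is a tuple $(r_1/s_1,\dots,r_N/s_N)$ with product $\alpha$, $r_n,s_n\in\mathbb N$, $r_n/s_n\ne1$, $\gcd(r_m,s_n)=1$ for all $m,n$; for $\alpha=p^a/q^b$ these all have the form $(p^{a_1}/q^{b_1},\dots,p^{a_N}/q^{b_N})$.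 Two tuples are equivalent if they have the same length and differ by a permutation of entries. $\mathcal B(\alpha)$ denotes the set of equivalence classes of factorizations $(p^{a_1}/q^{b_1},\dots,p^{a_N}/q^{b_N})$ of $\alpha$ with every $(a_n,b_n)\in\mathcal G\cap(\mathcal U_1(\xi)\cup\mathcal L_2(\xi))$. Let $(a_1,b_1),\dots,(a_N,b_N)$ be the complete list of upper or lower best approximations to $\xi$ with $a_n\le a$ and $b_n\le b$, ordered so that $b_1\le\dots\le b_N$ and $a_n\le a_{n+1}$ whenever $b_n=b_{n+1}$. The characteristic transformation of $\alpha$ is the linear map $T_\alpha:\mathbb R^N\to\mathbb R^2$ with matrix having first row $(a_1,\dots,a_N)$ and second row $(b_1,\dots,b_N)$. $\mathcal V(\alpha)$ is the set of $\mathbf x=(x_1,\dots,x_N)^T$ with all $x_n\in\mathbb N_0$ and $T_\alpha(\mathbf x)=(a,b)^T$. For $\mathbf x\in\mathcal V(\alpha)$, $A_{\mathbf x}$ is the tuple consisting of $x_1$ copies of $p^{a_1}/q^{b_1}$, then $x_2$ copies of $p^{a_2}/q^{b_2}$, ..., then $x_N$ copies of $p^{a_N}/q^{b_N}$. *)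

(* Defs.v *)
From HB Require Import structures.
From mathcomp Require Import all_boot all_order all_algebra.
From mathcomp Require Import archimedean.
From mathcomp Require Import all_classical all_reals all_analysis.

Import Order.TTheory GRing.Theory Num.Theory.

Local Open Scope classical_set_scope.
Local Open Scope ring_scope.

Section BestApproximations.
Context {R : realType}.
Implicit Types (xi : R) (ab mn : nat * nat).

Definition pairsN : set (nat * nat) := [set ab | ab != (0, 0)%N].

Definition pairsG : set (nat * nat) :=
  [set ab | pairsN ab /\ gcdn ab.1 ab.2 = 1%N].

(* a/b in the extended reals, with a/0 = +oo; only used on [pairsN] *)
Definition efrac ab : \bar R :=
  if ab.2 == 0%N then +oo%E else (ab.1%:R / ab.2%:R)%:E.

Definition is_min (S : set (\bar R)) (x : \bar R) : Prop := S x /\ lbound S x.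
Definition is_max (S : set (\bar R)) (x : \bar R) : Prop := S x /\ ubound S x.

Definition upperU xi : set (nat * nat) :=
  [set ab | pairsN ab /\ ab.2%:R * xi < ab.1%:R].

Definition lowerL xi : set (nat * nat) :=
  [set ab | pairsN ab /\ ab.1%:R < ab.2%:R * xi].

Definition upperU1 xi : set (nat * nat) :=
  [set ab | upperU xi ab /\
    is_min [set efrac mn | mn in [set mn | upperU xi mn /\ (mn.1 <= ab.1)%N]]
           (efrac ab)].

Definition lowerL2 xi : set (nat * nat) :=
  [set ab | lowerL xi ab /\
    is_max [set efrac mn | mn in [set mn | lowerL xi mn /\ (mn.2 <= ab.2)%N]]
           (efrac ab)].

Definition upper_best_approx xi : set (nat * nat) := pairsG `&` upperU1 xi.
Definition lower_best_approx xi : set (nat * nat) := pairsG `&` lowerL2 xi.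

Definition best_approx xi : set (nat * nat) :=
  upper_best_approx xi `|` lower_best_approx xi.

(* The comprehension is row-major, so the second components vary slowest; see
   [mem_best_list] and [sorted_best_list]. *)
Definition best_list xi (a b : nat) : seq (nat * nat) :=
  [seq mn <- [seq (m, n) | n <- iota 0 b.+1, m <- iota 0 a.+1]
     | `[< best_approx xi mn >]].

Lemma mem_best_list xi a b mn :
  mn \in best_list xi a b <->
  [/\ best_approx xi mn, (mn.1 <= a)%N & (mn.2 <= b)%N].
Proof.
rewrite mem_filter; split.
  move=> /andP[/asboolP bmn /allpairsP[[n m] [nb ma mnE]]].
  by move: nb ma; rewrite mnE !mem_iota !add0n !ltnS in bmn *.
move=> [bmn ma nb]; apply/andP; split; first exact/asboolP.
apply/allpairsP; exists (mn.2, mn.1); rewrite !mem_iota !add0n !ltnS.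
by split => //=; case: mn {bmn ma nb}.
Qed.

(* Strictness also shows that the list has no repetition. *)
Lemma sorted_best_list xi a b :
  sorted (fun u v => (u.2 < v.2) || ((u.2 == v.2) && (u.1 < v.1)))%N
         (best_list xi a b).
Proof.
apply/pairwise_sorted/pairwise_filter.
move: (iota_ltn_sorted 0 b.+1) (iota_ltn_sorted 0 a.+1).
elim: (iota 0 b.+1) (iota 0 a.+1) => //= n s IHs r sorted_s sorted_r.
have gt_n : all (ltn n) s by apply: order_path_min sorted_s; exact: ltn_trans.
rewrite pairwise_cat (IHs _ (path_sorted sorted_s) sorted_r) andbT.
apply/andP; split.
  apply/allrelP => _ _ /mapP[m _ ->] /allpairsP[[k l] /= [ks _ ->]] /=.
  by have /= -> := allP gt_n _ ks.
rewrite pairwise_map; move: sorted_r; rewrite (sorted_pairwise ltn_trans).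
by apply: sub_pairwise => i j /=; rewrite ltnn eqxx.
Qed.

(* The transformation T_alpha for alpha = p^a/q^b and xi = log q / log p. *)
Definition char_mx xi (a b : nat) : 'M[R]_(2, size (best_list xi a b)) :=
  \matrix_(i, n) (let ab := tnth (in_tuple (best_list xi a b)) n in
                  if i == 0 then ab.1%:R else ab.2%:R).

Definition char_transformation xi (a b : nat)
    (x : 'cV[R]_(size (best_list xi a b))) : 'cV[R]_2 :=
  char_mx xi a b *m x.

Definition setV xi (a b : nat) : set 'cV[R]_(size (best_list xi a b)) :=
  [set x : 'cV[R]_(size (best_list xi a b)) |
     (forall n, x n 0 \is a Num.nat) /\
     char_transformation xi a b x = \col_i (if i == 0 then a%:R else b%:R)].

Definition pq_frac (p q : nat) ab : rat := p%:R ^+ ab.1 / q%:R ^+ ab.2.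

(* [Num.truncn] turns a real [x n 0] lying in N_0 into the natural number
   itself. *)
Definition tupleA (p q : nat) xi (a b : nat)
    (x : 'cV[R]_(size (best_list xi a b))) : seq rat :=
  flatten [seq nseq (Num.truncn (x n 0))
                    (pq_frac p q (tnth (in_tuple (best_list xi a b)) n))
          | n <- enum 'I_(size (best_list xi a b))].

Definition factorization (alpha : rat) (t : seq rat) : Prop :=
  exists rs : seq (nat * nat),
    [/\ t = [seq u.1%:R / u.2%:R | u <- rs],
        \prod_(y <- t) y = alpha,
        {in rs, forall u, (0 < u.1)%N /\ (0 < u.2)%N},
        {in t, forall y, y != 1}
      & {in rs &, forall u v, gcdn u.1 v.2 = 1%N}].

(* Equivalence class of a tuple under permutation of its entries, as the set of
   its members; a permutation of a factorization is again a factorization. *)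
Definition perm_class (t : seq rat) : set (seq rat) := [set s | perm_eq t s].

Definition setB (p q : nat) xi (alpha : rat) : set (set (seq rat)) :=
  [set perm_class t | t in [set t | factorization alpha t /\
    exists abs : seq (nat * nat),
      t = map (pq_frac p q) abs /\
      {in abs, forall ab,
         (pairsG `&` (upperU1 xi `|` lowerL2 xi)) ab}]].

End BestApproximations.

(* Main.v *)
(* By unique factorization, p^c/q^d determines (c, d), so a factorization of
   p^a/q^b with best-approximation exponents is, up to order, a multiset of best
   approximations with sum (a, b). All its members lie below (a, b), hence in
   the list of best approximations, and a multiset over a repetition-free list
   is the same thing as its vector of multiplicities. *)
Require Import Defs.
From HB Require Import structures.
From mathcomp Require Import all_boot all_order all_algebra.
From mathcomp Require Import archimedean.
From mathcomp Require Import all_classical all_reals all_analysis.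

Import Order.TTheory GRing.Theory Num.Theory.
Local Open Scope classical_set_scope.
Local Open Scope ring_scope.

Lemma count_flatten_nseq (I : finType) (T : eqType) (f : I -> T) (m : I -> nat)
    (i : I) : injective f ->
  count_mem (f i) (flatten [seq nseq (m j) (f j) | j <- enum I]) = m i.
Proof.
move=> f_inj; rewrite count_flatten -map_comp sumnE big_map big_enum /=.
rewrite (bigD1 i) //= count_nseq /= eqxx mul1n big1 ?addn0// => j ji.
by rewrite count_nseq /= (inj_eq f_inj) (negPf ji).
Qed.

Lemma mem_flatten_nseq (I : finType) (T : eqType) (f : I -> T) (m : I -> nat)
    (y : T) : y \in flatten [seq nseq (m j) (f j) | j <- enum I] ->
  exists j, y = f j.
Proof.
move=> /flattenP[s /mapP[j _ ->]]; rewrite mem_nseq => /andP[_ /eqP ->].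
by exists j.
Qed.

Lemma perm_flatten_nseq_count (I : finType) (T : eqType) (f : I -> T)
    (s : seq T) : injective f -> {in s, forall y, exists j, y = f j} ->
  perm_eq s (flatten [seq nseq (count_mem (f j) s) (f j) | j <- enum I]).
Proof.
(* [perm_eq] only asks for equal counts at the members of either list, and all of these lie in the
   range of [f]. *)
move=> f_inj sf; apply/allP => y; rewrite mem_cat => ys.
have [j ->] : exists j, y = f j by case/orP: ys => [/sf|/mem_flatten_nseq].
by rewrite /= count_flatten_nseq.
Qed.

Lemma sum_flatten_nseq (I : finType) (T : Type) (f : I -> T) (m : I -> nat)
    (g : T -> nat) :
  (\sum_(y <- flatten [seq nseq (m j) (f j) | j <- enum I]) g y =
   \sum_j g (f j) * m j)%N.
Proof.
rewrite big_flatten big_map big_enum /=; apply: eq_bigr => j _.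
by rewrite big_nseq iter_addn_0.
Qed.

Section PowerQuotients.
Variables p q : nat.

Lemma pq_fracE (u : nat * nat) :
  pq_frac p q u = (p ^ u.1)%:R / (q ^ u.2)%:R.
Proof. by rewrite /pq_frac !natrX. Qed.

Lemma prod_pq_frac (s : seq (nat * nat)) :
  \prod_(y <- map (pq_frac p q) s) y =
  pq_frac p q (\sum_(u <- s) u.1, \sum_(u <- s) u.2)%N.
Proof.
rewrite big_map /pq_frac /=; elim: s => [|u s IHs].
  by rewrite !big_nil !expr0 divr1.
by rewrite !big_cons IHs !exprD invfM mulrACA.
Qed.

Hypotheses (p_prime : prime p) (q_prime : prime q) (ltpq : (p < q)%N).

(** Cross-multiplication leaves p^a q^d = p^c q^b in the naturals. As p and q are distinct primes,
    the p-adic valuation gives a = c and the q-adic one b = d. *)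
Lemma pq_frac_inj : injective (pq_frac p q).
Proof.
move=> [a b] [c d]; rewrite !pq_fracE /= => /eqP.
have p0 := prime_gt0 p_prime; have q0 := prime_gt0 q_prime.
rewrite eqr_div ?pnatr_eq0 -?lt0n ?expn_gt0 ?q0// -!natrM eqr_nat => /eqP E.
have pq : (p == q) = false by rewrite ltn_eqF.
have /(congr1 (logn p)) := E; have /(congr1 (logn q)) := E.
rewrite !lognM ?expn_gt0 ?p0 ?q0// !lognX !logn_prime// !eqxx.
by rewrite eq_sym pq !muln0 !muln1 !addn0 !add0n => -> ->.
Qed.

Lemma factorization_pq_frac (s : seq (nat * nat)) (alpha : rat) :
  {in s, forall u, u != (0, 0)%N} ->
  \prod_(y <- map (pq_frac p q) s) y = alpha ->
  factorization alpha (map (pq_frac p q) s).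
Proof.
move=> s0 prod_s; exists [seq (p ^ u.1, q ^ u.2)%N | u <- s]; split => //.
- by rewrite -map_comp; apply: eq_map => u; rewrite pq_fracE.
- by move=> _ /mapP[u _ ->]; rewrite !expn_gt0 !prime_gt0.
- move=> _ /mapP[u us ->]; apply: contra (s0 _ us) => /eqP u1.
  (* The value 1 is [pq_frac] at (0, 0), so injectivity excludes it for every other pair. *)
  apply/eqP/pq_frac_inj; rewrite u1.
  by rewrite /pq_frac !expr0 divr1.
- move=> _ _ /mapP[u _ ->] /mapP[v _ ->] /=; apply/eqP.
  rewrite -/(coprime _ _) coprimeXl// coprimeXr//.
  by rewrite prime_coprime// dvdn_prime2// ltn_eqF.
Qed.

End PowerQuotients.

Section BestApproximationList.
Context {R : realType}.
Variables (xi : R) (a b : nat).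

Let nth_best (n : 'I_(size (best_list xi a b))) :=
  tnth (in_tuple (best_list xi a b)) n.

Lemma best_list_uniq : uniq (best_list xi a b).
Proof.
by rewrite filter_uniq// allpairs_uniq ?iota_uniq// => -[? ?] [? ?] _ _ [-> ->].
Qed.

Lemma nth_best_inj : injective nth_best.
Proof. by apply/tuple_uniqP; exact: best_list_uniq. Qed.

(** Both sides of the matrix equation are casts of naturals, and the cast into the reals is
    injective; from here on only natural sums matter. *)
Lemma setV_natP (m : 'I_(size (best_list xi a b)) -> nat) :
  setV xi a b (\col_n (m n)%:R) <->
  (\sum_n (nth_best n).1 * m n)%N = a /\ (\sum_n (nth_best n).2 * m n)%N = b.
Proof.
have TE i : char_transformation xi a b (\col_n (m n)%:R) i 0 =
    (\sum_n (if (i == 0)%R then (nth_best n).1 else (nth_best n).2) * m n)%N%:R.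
  rewrite mxE natr_sum; apply: eq_bigr => n _; rewrite !mxE natrM.
  by case: ifP.
split=> [[_ /matrixP T]|[Ea Eb]].
  have := T 0 0; have := T 1 0; rewrite !TE !mxE /=.
  by move=> /eqP + /eqP; rewrite !eqr_nat => /eqP -> /eqP ->.
split=> [n|]; first by rewrite mxE natr_nat.
by apply/matrixP => i j; rewrite ord1 TE mxE; case: ifP => _; rewrite ?Ea ?Eb.
Qed.

Lemma setV_col (x : 'cV[R]_(size (best_list xi a b))) : setV xi a b x ->
  exists m : 'I_(size (best_list xi a b)) -> nat, x = \col_n (m n)%:R.
Proof.
move=> [xN _]; exists (fun n => Num.truncn (x n 0)).
by apply/matrixP => i j; rewrite ord1 mxE truncnK.
Qed.

(** Pulling [pq_frac] outside lets permutations and multiplicities be studied on exponent pairs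
    instead of rationals. *)
Lemma tupleA_col (p q : nat) (m : 'I_(size (best_list xi a b)) -> nat) :
  tupleA p q xi a b (\col_n (m n)%:R) = map (pq_frac p q)
    (flatten [seq nseq (m n) (nth_best n)
             | n <- enum 'I_(size (best_list xi a b))]).
Proof.
rewrite map_flatten -map_comp; congr flatten.
by apply: eq_map => n /=; rewrite map_nseq mxE natrK.
Qed.

End BestApproximationList.

Theorem theorem4p1 (R : realType) (p q : nat) (p_prime : prime p)
    (q_prime : prime q) (ltpq : (p < q)%N) (xi : R)
    (xiE : xi = ln q%:R / ln p%:R) (a b : nat)
    (best_ab : best_approx xi (a, b)) (alpha : rat)
    (alphaE : alpha = p%:R ^+ a / q%:R ^+ b) :
  set_bij (setV xi a b) (setB p q xi alpha)
    (fun x => perm_class (tupleA p q xi a b x)).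
Proof.
have bestE : best_approx xi = pairsG `&` (upperU1 xi `|` lowerL2 xi).
  by rewrite setIUr.
have alpha_pq : alpha = pq_frac p q (a, b) by [].
have pq_inj := pq_frac_inj _ _ p_prime q_prime ltpq.
split.
- move=> x Vx; have [m xE] := setV_col _ _ _ _ Vx.
  exists (tupleA p q xi a b x) => //; move: Vx; rewrite {x}xE tupleA_col.
  set s := flatten _ => /setV_natP[sum1 sum2].
  have s_best : {in s, forall u, best_approx xi u}.
    move=> _ /mem_flatten_nseq[n ->].
    by case/mem_best_list: (mem_tnth n (in_tuple (best_list xi a b))).
  split; last by exists s; split=> // u /s_best; rewrite bestE.
  apply: factorization_pq_frac => // [u /s_best|].
    by rewrite bestE => -[[]].
  by rewrite prod_pq_frac alpha_pq !sum_flatten_nseq sum1 sum2.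
- move=> x y /set_mem/setV_col[m ->] /set_mem/setV_col[m' ->] mm'.
  have : perm_eq (tupleA p q xi a b (\col_n (m n)%:R))
                 (tupleA p q xi a b (\col_n (m' n)%:R)).
    (* The goal says that the second tuple belongs to the class of the first; the classes agree, and
       each tuple belongs to its own. *)
    by rewrite -[is_true _]/(perm_class _ _) mm'; exact: perm_refl.
  (* Injectivity of [pq_frac] turns this into a permutation of exponent pairs; counting the n-th
     best approximation on both sides then recovers the n-th coordinate. *)
  rewrite !tupleA_col => /(perm_map_inj pq_inj)/permP eq_count.
  apply/matrixP => n j; rewrite !mxE; congr _%:R.
  have := eq_count (pred1 (tnth (in_tuple (best_list xi a b)) n)).
  by rewrite !count_flatten_nseq//; exact: nth_best_inj.
- move=> _ [t [[rs [_ prod_t _ _ _]] [s [tE s_best]]] <-].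
  (* Comparing exponents in the product shows that the pairs of [s] sum to (a, b). Each summand is
     then bounded by it componentwise, which places it in the list. *)
  move: prod_t; rewrite {t}tE prod_pq_frac alpha_pq => /pq_inj[sum1 sum2].
  have s_list : {in s, forall u, exists n,
      u = tnth (in_tuple (best_list xi a b)) n}.
    move=> u us; apply/tnthP/mem_best_list; split.
    + by rewrite bestE; exact: s_best.
    + by rewrite -sum1 (big_rem u us) leq_addr.
    + by rewrite -sum2 (big_rem u us) leq_addr.
  have := perm_flatten_nseq_count _ _ _ s (nth_best_inj xi a b) s_list.
  (* The preimage is the vector of multiplicities in [s]; its tuple is a reordering of the given
     one, so both sums are unchanged. *)
  pose m n := count_mem (tnth (in_tuple (best_list xi a b)) n) s.
  move=> s_perm.
  exists (\col_n (m n)%:R).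
    apply/setV_natP; rewrite -!sum_flatten_nseq.
    by rewrite -(perm_big _ s_perm) -[X in _ /\ X = _](perm_big _ s_perm).
  (* Permuted tuples have the same class: each inclusion is transitivity of [perm_eq]. *)
  rewrite tupleA_col; apply/seteqP; split=> t; apply: perm_trans.
    exact: perm_map.
  by apply: perm_map; rewrite perm_sym.
Qed.
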